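(* In the setting and notation of the context, for each $i=1,\dots,N$ let $\boldsymbol{y}_i'$ be a target value satisfying $$\frac{\partial l^{\text{train}}(f(\boldsymbol{x}_i;\boldsymbol{\theta}),\boldsymbol{y}_i')}{\partial\boldsymbol{\theta}}\bigg|_{\boldsymbol{\theta}=\boldsymbol{\theta}^*}=0,$$ and let the baseline dataset be $\overline{\mathcal{D}}_{\text{train}}=\{(\boldsymbol{x}_i,\boldsymbol{y}_i')\}_{i=1}^N$ (that is, $\overline{\boldsymbol{y}}_i=\boldsymbol{y}_i'$). Then the following hold. (1) The influence function is a special case of the integrated influence under the assumption that $\boldsymbol{G}(t)$ and $\boldsymbol{H}(t)$ are independent of $t$: if $\boldsymbol{G}(t)$ and $\boldsymbol{H}(t)$ are independent of $t\in[0,1]$, then for every $i$ $$-\int_0^1\boldsymbol{G}(t)\boldsymbol{H}^{-1}(t)\boldsymbol{J}_i(t)\frac{\partial\rho_i(t)}{\partial t}\,dt=\mathrm{IF}(i).$$ (2) Moreover, if $\frac{\partial l^{\text{train}}(f(\boldsymbol{x};\boldsymbol{\theta}),\boldsymbol{y})}{\partial\boldsymbol{\theta}}$ is linear (in the sense of affine) with respect to $\boldsymbol{y}$, such as when $l^{\text{train}}$ is the mean squared error loss or the cross-entropy loss, then for every $i$ the influence function is exactly equal to the discrete integrated influence with $K=1$ and this baseline dataset: $$-\boldsymbol{G}(t_1)\boldsymbol{H}^{-1}(t_1)\boldsymbol{J}_i(t_1)\,(\boldsymbol{y}_i-\boldsymbol{y}_i')=\mathrm{IF}(i),\qquad t_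1=1.$$
   Context: Setting. $\mathcal{D}_{\text{train}}=\{(\boldsymbol{x}_i,\boldsymbol{y}_i)\}_{i=1}^N$ is a training set with feature vectors $\boldsymbol{x}_i$ and target vectors $\boldsymbol{y}_i$; $f(\cdot;\boldsymbol{\theta})$ is a model with parameters $\boldsymbol{\theta}$; $l^{\text{train}}(f(\boldsymbol{x};\boldsymbol{\theta}),\boldsymbol{y})$ is a per-sample training loss, and the training loss $L^{\text{train}}(\mathcal{D})$ of a dataset $\mathcal{D}$ is the empirical average of the per-sample losses over $\mathcal{D}$. The parameter $\boldsymbol{\theta}^*$ is the minimizer of $L^{\text{train}}(\mathcal{D}_{\text{train}})$. $\boldsymbol{\hat z}$ is a fixed test sample with test loss $L^{\text{test}}(\boldsymbol{\hat z},\boldsymbol{\theta})$. The derivatives and inverse Hessians below are assumed to exist. Paths. A baseline dataset $\overline{\mathcal{D}}_{\text{train}}=\{(\boldsymbol{x}_i,\overline{\boldsymbol{y}}_i)\}_{i=1}^N$ has the same size and features as $\mathcal{D}_{\text{train}}$ but different targets. A target path $\rho_i$ is a continuous and smooth function of $t\in[0,1]$ with values in a continuous manifold $\mathcal{M}$ containing all targets of both datasets, such that $\rho_i(0)=\overline{\boldsymbol{y}}_i$ and $\rho_i(1)=\boldsymbol{y}_i$. The dataset path is $\Gamma(t)=\{(\boldsymbol{x}_i,\rho_i(t))\}_{i=1}^N$, so $\Gamma(0)=\overline{\mathcal{D}}_{\text{train}}$ and $\Gamma(1)=\mathcal{D}_{\text{train}}$. $\boldsymbol{\theta}(\Gamma(t))$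 denotes the minimizer of $L^{\text{train}}(\Gamma(t))$ over $\boldsymbol{\theta}$, so $\boldsymbol{\theta}(\Gamma(1))=\boldsymbol{\theta}^*$. Derivatives. $\boldsymbol{G}(t)=\frac{\partial L^{\text{test}}(\boldsymbol{\hat z},\boldsymbol{\theta})}{\partial\boldsymbol{\theta}}$ (a row vector) at $\boldsymbol{\theta}=\boldsymbol{\theta}(\Gamma(t))$; $\boldsymbol{H}(t)$ is the Hessian of $L^{\text{train}}(\Gamma(t))$ with respect to $\boldsymbol{\theta}$ at $\boldsymbol{\theta}(\Gamma(t))$; $\boldsymbol{J}_i(t)=\frac{\partial^2 l^{\text{train}}(f(\boldsymbol{x}_i;\boldsymbol{\theta}),\boldsymbol{y})}{\partial\boldsymbol{\theta}\,\partial\boldsymbol{y}}$ at $\boldsymbol{y}=\rho_i(t)$ and $\boldsymbol{\theta}=\boldsymbol{\theta}(\Gamma(t))$. Integrated influence of sample $i$: $I(i)=-\int_0^1\boldsymbol{G}(t)\boldsymbol{H}^{-1}(t)\boldsymbol{J}_i(t)\frac{\partial\rho_i(t)}{\partial t}dt$. Discrete integrated influence with $K$ steps, $0=t_0<t_1<\dots<t_K=1$: $-\sum_{k=1}^K\boldsymbol{G}(t_k)\boldsymbol{H}^{-1}(t_k)\boldsymbol{J}_i(t_k)(\rho_i(t_k)-\rho_i(t_{k-1}))$. Influence function of sample $i$: $\mathrm{IF}(i)=-\boldsymbol{G}\boldsymbol{H}^{-1}\frac{\partial l^{\text{train}}(f(\boldsymbol{x}_i;\boldsymbol{\theta}),\boldsymbol{y}_i)}{\partial\boldsymbol{\theta}}\big|_{\boldsymbol{\theta}=\boldsymbol{\theta}^*}$,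 where $\boldsymbol{G}=\boldsymbol{G}(1)$ and $\boldsymbol{H}=\boldsymbol{H}(1)$ are the test-loss gradient and the training-loss Hessian at $\boldsymbol{\theta}^*$.
   Formalization: Part (1), false as literally stated, is proved with the added assumption that for the sample i at hand J_i(t) equals, for all t in [0,1], the mixed derivative of the loss at y=ρ_i(t) and θ=θ* (assumed to exist there), instead of only at θ(Γ(t)). *)

(* Defs.v *)
From HB Require Import structures.
From mathcomp Require Import all_boot all_order all_algebra.
From mathcomp Require Import all_classical all_reals all_analysis.

Set Implicit Arguments.
Unset Strict Implicit.
Unset Printing Implicit Defensive.

Import Order.TTheory GRing.Theory Num.Theory.
Import numFieldNormedType.Exports.

Local Open Scope classical_set_scope.
Local Open Scope ring_scope.

(* Parameters, features, model outputs and targets are row vectors; a vector *)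
(* that is multiplied on its left by a matrix is transposed first. The       *)
(* library Jacobian acts on row vectors from the right, 'd g a v = v *m 'J g a, *)
(* so the usual matrix of partial derivatives d g_a / d v_b is ('J g v)^T.   *)

Section Derivatives.
Context {R : realType} {p : nat}.

Definition grad (F : 'rV[R]_p -> R) (th : 'rV[R]_p) : 'rV[R]_p :=
  \row_a 'D_(delta_mx 0 a) F th.

Definition hessian (F : 'rV[R]_p -> R) (th : 'rV[R]_p) : 'M[R]_p :=
  ('J (grad F) th)^T.

Definition hessian_exists (F : 'rV[R]_p -> R) (th : 'rV[R]_p) : Prop :=
  (\forall u \near th, differentiable F u) /\ differentiable (grad F) th.

Definition is_minimizer (F : 'rV[R]_p -> R) (th : 'rV[R]_p) : Prop :=
  forall u, F th <= F u.

Definition affine_map {m : nat} (g : 'rV[R]_m -> 'rV[R]_p) : Prop :=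
  exists (A : {linear 'rV[R]_m -> 'rV[R]_p}) (b : 'rV[R]_p),
    forall v, g v = A v + b.

End Derivatives.

Section Loss.
Context {R : realType} {d p q m : nat}.
Variables (f : 'rV[R]_d -> 'rV[R]_p -> 'rV[R]_q) (l : 'rV[R]_q -> 'rV[R]_m -> R).

Definition sample_grad (x : 'rV[R]_d) (v : 'rV[R]_m) (th : 'rV[R]_p) : 'rV[R]_p :=
  grad (fun u => l (f x u) v) th.

Definition mixed_deriv (x : 'rV[R]_d) (th : 'rV[R]_p) (v : 'rV[R]_m) : 'M[R]_(p, m) :=
  ('J (fun w => sample_grad x w th) v)^T.

Definition mixed_deriv_exists (x : 'rV[R]_d) (th : 'rV[R]_p) (v : 'rV[R]_m) : Prop :=
  (\forall w \near v, differentiable (fun u => l (f x u) w) th) /\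
  differentiable (fun w => sample_grad x w th) v.

Definition sample_grad_affine : Prop :=
  forall x th, affine_map (fun v => sample_grad x v th).

Definition dataset (N : nat) := {ffun 'I_N -> 'rV[R]_d * 'rV[R]_m}.

Definition mk_dataset {N : nat} (x : 'I_N -> 'rV[R]_d) (y : 'I_N -> 'rV[R]_m) :
  dataset N := [ffun i => (x i, y i)].

Definition train_loss {N : nat} (D : dataset N) (th : 'rV[R]_p) : R :=
  N%:R^-1 * \sum_(i < N) l (f (D i).1 th) (D i).2.

End Loss.

Definition mse {R : realType} {m : nat} (u v : 'rV[R]_m) : R :=
  m%:R^-1 * \sum_(k < m) (u 0 k - v 0 k) ^+ 2.

(* The first argument is the vector of predicted class probabilities. *)
Definition cross_entropy {R : realType} {m : nat} (u v : 'rV[R]_m) : R :=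
  - \sum_(k < m) v 0 k * ln (u 0 k).

(* Continuously differentiable in the interior and continuous up to the end  *)
(* points; derive1 is a two-sided derivative, hence no condition on it at the  *)
(* end points. Every path smooth on the closed interval satisfies this.      *)
Definition smooth_path {R : realType} {m : nat} (r : R -> 'rV[R]_m) : Prop :=
  [/\ {within `[0, 1], continuous r},
      {in `]0, 1[, forall t, derivable r t 1} &
      {in `]0, 1[, continuous (derive1 r)}].

Definition target_path {R : realType} {m : nat} (M : set 'rV[R]_m)
    (y0 y1 : 'rV[R]_m) (r : R -> 'rV[R]_m) : Prop :=
  [/\ smooth_path r, forall t, t \in `[0, 1] -> M (r t), r 0 = y0 & r 1 = y1].

Section Influence.
Context {R : realType} {d p q m N : nat} {Z : Type}.
Variables (f : 'rV[R]_d -> 'rV[R]_p -> 'rV[R]_q) (l : 'rV[R]_q -> 'rV[R]_m -> R).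
Variables (Ltest : Z -> 'rV[R]_p -> R) (z : Z).
Variable theta : @dataset R d m N -> 'rV[R]_p.
Variable x : 'I_N -> 'rV[R]_d.

Definition influence (y : 'I_N -> 'rV[R]_m) (i : 'I_N) : R :=
  let D := mk_dataset x y in
  - (grad (Ltest z) (theta D) *m invmx (hessian (train_loss f l D) (theta D))
       *m (sample_grad f l (x i) (y i) (theta D))^T) 0 0.

Variable rho : 'I_N -> R -> 'rV[R]_m.

Definition path_dataset (t : R) : @dataset R d m N := mk_dataset x (rho ^~ t).

Definition path_grad (t : R) : 'rV[R]_p :=
  grad (Ltest z) (theta (path_dataset t)).

Definition path_hessian (t : R) : 'M[R]_p :=
  hessian (train_loss f l (path_dataset t)) (theta (path_dataset t)).

Definition path_mixed (i : 'I_N) (t : R) : 'M[R]_(p, m) :=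
  mixed_deriv f l (x i) (theta (path_dataset t)) (rho i t).

Definition path_integrand (i : 'I_N) (t : R) : R :=
  (path_grad t *m invmx (path_hessian t) *m path_mixed i t
     *m (derive1 (rho i) t)^T) 0 0.

Definition integrated_influence (i : 'I_N) : R :=
  - \int[lebesgue_measure]_(t in `[0, 1]) path_integrand i t.

Definition discrete_integrated_influence (K : nat) (s : nat -> R) (i : 'I_N) : R :=
  - \sum_(1 <= k < K.+1)
      (path_grad (s k) *m invmx (path_hessian (s k)) *m path_mixed i (s k)
         *m (rho i (s k) - rho i (s k.-1))^T) 0 0.

Definition path_derivs_exist : Prop :=
  forall t, t \in `[0, 1] ->
  [/\ differentiable (Ltest z) (theta (path_dataset t)),
      hessian_exists (train_loss f l (path_dataset t)) (theta (path_dataset t)),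
      path_hessian t \in unitmx &
      forall i, mixed_deriv_exists f l (x i) (theta (path_dataset t)) (rho i t)].

End Influence.

(* Main.v *)
Require Import Defs.
From HB Require Import structures.
From mathcomp Require Import all_boot all_order all_algebra.
From mathcomp Require Import all_classical all_reals all_analysis.
From mathcomp Require Import measurable_realfun ring lra.

Set Implicit Arguments.
Unset Strict Implicit.
Unset Printing Implicit Defensive.

Import Order.TTheory GRing.Theory Num.Theory.
Import numFieldNormedType.Exports.

Local Open Scope classical_set_scope.
Local Open Scope ring_scope.

(* With G and H constant, G H^-1 J_i(t) rho_i'(t) is the derivative of
   t |-> G H^-1 (dl/dtheta (x_i, rho_i(t)))^T at theta-star, which vanishes at
   t = 0 by the choice of the baseline and gives minus the influence function
   at t = 1. As J_i need not be continuous, this derivative is only known to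
   exist at every interior point and to be integrable, so the fundamental
   theorem of calculus is proved in this generality (Rudin, Real and Complex
   Analysis, Theorem 7.21). In the affine case, the increment of dl/dtheta
   between the two targets is exactly its Jacobian applied to their difference. *)

(** * Fundamental theorem of calculus for an integrable derivative *)

(** Points at which the inequality holds with a slack [e] have a supremum that is again such a
    point, because [T] is continuous and [Psi] monotone; unless it equals [b], the right-growth
    hypothesis yields such a point beyond it. *)
Lemma increment_le_of_right_growth (R : realType) (a b : R) (T Psi : R -> R) :
  a < b -> {within `[a, b], continuous T} ->
  {in `[a, b] &, {homo Psi : x y / x <= y}} ->
  (forall x, a < x < b ->
     exists2 y, x < y <= b & T y - T x <= Psi y - Psi x) ->
  T b - T a <= Psi b - Psi a.
Proof.
move=> ab cT ndPsi step; apply/ler_addgt0Pr => e e0.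
have near_T x e' : x \in `[a, b] -> 0 < e' ->
    exists2 r, 0 < r & forall y, y \in `[a, b] -> `|x - y| < r -> `|T x - T y| < e'.
  move=> xab e'0.
  have /cvgrPdist_lt/(_ _ e'0) : T y @[y --> within `[a, b] (nbhs x)] --> T x.
    by have /subspace_continuousP := cT; apply.
  rewrite near_withinE => /nbhs_ballP[r /= r0 rT]; exists r => // y yab xy.
  exact: rT.
pose S := [set x | x \in `[a, b] /\ T x - T a <= Psi x - Psi a + e].
have ubS : ubound S b by move=> x [/itvP xab _]; rewrite xab.
(* At [a] itself [step] gives nothing: the slack [e] and the continuity of [T] at [a] supply a first
   point of [S] to the right of [a]. *)
have [c ac Sc] : exists2 c, a < c & S c.
  have aab : a \in `[a, b] by rewrite in_itv/= lexx ltW.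
  have [r r0 rT] := near_T a e aab e0.
  pose c := Num.min b (a + r / 2).
  have ac : a < c by rewrite lt_min ab ltrDl divr_gt0.
  have cab : c \in `[a, b] by rewrite in_itv/= (ltW ac) ge_min lexx.
  exists c => //; split=> //.
  have /(rT _ cab) : `|a - c| < r.
    rewrite distrC ger0_norm ?subr_ge0 1?ltW// ltrBlDl.
    by rewrite gt_min ltrD2l ltr_pdivrMr// ltr_pMr// ltr1n orbT.
  rewrite distrC => /(le_lt_trans (ler_norm _))/ltW/le_trans; apply.
  by rewrite lerDr subr_ge0 ndPsi// ltW.
have hubS : has_ubound S by exists b.
have supS : has_sup S by split=> //; exists c.
have Mb : sup S <= b by apply: ge_sup => //; exists c.
have aM : a < sup S by apply: (lt_le_trans ac); exact: (ub_le_sup hubS).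
have Mab : sup S \in `[a, b] by rewrite in_itv/= (ltW aM).
(* Points [x] of [S] close to the supremum have [T x] close to [T (sup S)] and
   [Psi x <= Psi (sup S)], so the bound passes to the limit. *)
have SM : S (sup S).
  split=> //; apply/ler_addgt0Pr => e' e'0.
  have [r r0 rT] := near_T _ _ Mab e'0.
  have [x Sx Mx] := sup_adherent r0 supS.
  have xM : x <= sup S := ub_le_sup hubS Sx.
  have /(rT _ Sx.1) : `|sup S - x| < r.
    by rewrite ger0_norm ?subr_ge0//; move: Mx; rewrite ltrBlDr ltrBlDl addrC.
  move=> /(le_lt_trans (ler_norm _)) TMx.
  have := ndPsi _ _ Sx.1 Mab xM; have := Sx.2; lra.
have [<-|Mltb] := eqVneq (sup S) b; first exact: SM.2.
have [y /andP[My yb] Ty] := step (sup S) ltac:(by rewrite aM lt_neqAle Mltb).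
suff /(ub_le_sup hubS) : S y by rewrite leNgt My.
split; first by rewrite in_itv/= yb andbT ltW// (lt_trans aM).
have := SM.2; lra.
Qed.

(* The function [v] is a sum of indicators of open sets covering the level sets
   [h > n * delta]; the lower bound holds on a whole neighbourhood because only
   finitely many of these sets are needed at a given point. *)
Lemma vitali_caratheodory_ge0 (R : realType) (D : set R) (h : R -> R) (e : R) :
  measurable D -> (lebesgue_measure D < +oo)%E ->
  measurable_fun D h -> (forall x, D x -> 0 <= h x) -> 0 < e ->
  exists v : R -> \bar R,
    [/\ measurable_fun setT v, forall x, (0 <= v x)%E,
        forall x, D x -> \forall y \near x, ((h x)%:E <= v y)%E &
        (\int[lebesgue_measure]_(x in D) v x <=
         \int[lebesgue_measure]_(x in D) (h x)%:E + e%:E)%E].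
Proof.
move=> mD Dfin mh h0 e0; pose mu := @lebesgue_measure R.
have muD : (mu D = (fine (mu D))%:E) by rewrite fineK// ge0_fin_numE.
have muD0 : 0 <= fine (mu D) by rewrite fine_ge0.
(* Two errors must add up to [e]: discretising [h] in steps of [del] costs [del * mu D], and
   enlarging the level sets to open sets costs [del]. *)
pose del := e / (fine (mu D) + 1).
have del0 : 0 < del by rewrite divr_gt0// ltr_wpDl.
pose A n := D `&` [set x | n%:R * del < h x].
have mA n : measurable (A n).
  have -> : A n = D `&` h @^-1` `]n%:R * del, +oo[.
    by apply/seteqP; split=> x [Dx] /=; rewrite in_itv/= andbT.
  exact: mh.
have /choice[V Vprop] n : exists U : set R,
    [/\ open U, A n `<=` U & (mu (U `\` A n) < (1 / (2 ^ n.+1)%:R)%:E)%E].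
  apply: lebesgue_regularity_outer => //; apply: le_lt_trans Dfin.
  by apply: le_measure; rewrite ?inE; [exact: mA|exact: mD|exact: subIsetl].
have mV n : measurable (V n) by apply: open_measurable; have [] := Vprop n.
(* Since [0 <= h], the sum of [u A n] over [n] lies between [h] and [h + del]. *)
pose u (W : nat -> set R) n x : \bar R := (del * \1_(W n) x)%:E.
have u0 W n x : (0 <= u W n x)%E by rewrite lee_fin mulr_ge0// ltW.
have mu_ W n E : measurable (W n) -> measurable_fun E (u W n).
  by move=> mW; apply/measurable_EFinP; apply: measurable_funM.
have uI W n : measurable (W n) ->
    (\int[mu]_(x in D) u W n x = del%:E * mu (W n `&` D))%E.
  move=> mW; rewrite /u; under eq_integral do rewrite EFinM.
  rewrite ge0_integralZl//; last 2 first.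
    by apply/measurable_EFinP.
    by rewrite lee_fin ltW.
  by rewrite integral_indic.
pose v x : \bar R := (\sum_(0 <= n <oo) u V n x)%E.
exists v; split.
- apply: ge0_emeasurable_sum => //.
  by move=> n _; exact: mu_.
- by move=> x; apply: nneseries_ge0.
- move=> x Dx.
  (* The least such [N] is taken, so that [x] lies in [A n] for every [n < N], and [N] terms of size
     [del] already reach [h x]. *)
  have [N hN] : exists N, (h x <= N%:R * del) /\
      forall n, (n < N)%N -> n%:R * del < h x.
    have exN : exists N, h x <= N%:R * del.
      exists (Num.truncn (h x / del)).+1; rewrite -ler_pdivrMr//.
      exact/ltW/truncnS_gt.
    exists (ex_minn exN); case: ex_minnP => N hN minN; split=> // n nN.
    by rewrite ltNge; apply/negP => /minN; rewrite leqNgt nN.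
  have nearV (i : 'I_N) : \forall y \near x, V i y.
    have [oV AV _] := Vprop i.
    by apply: open_nbhs_nbhs; split=> //; apply: AV; split=> //=; exact: hN.2.
  have := @filter_forall R 'I_N (fun i => V i) (nbhs x) (nbhs_filter x) nearV.
  apply: filterS => y Vy; apply: (@le_trans _ _ (\sum_(0 <= n < N) u V n y)%E).
    rewrite big_mkord; under eq_bigr => i _.
      rewrite /u indicE (mem_set (Vy i)) mulr1; over.
    rewrite sumEFin sumr_const card_ord lee_fin -mulr_natl; exact: hN.1.
  by apply: nneseries_lim_ge.
- rewrite /v integral_nneseries//; last by move=> n; exact: mu_.
  (* Replacing [A n] by [V n] costs at most [del / 2 ^ n.+1], and these costs sum to [del]. *)
  have le1 : (\sum_(0 <= n <oo) \int[mu]_(x in D) u V n x <=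
      \sum_(0 <= n <oo) (\int[mu]_(x in D) u A n x + (del / (2 ^ n.+1)%:R)%:E))%E.
    apply: lee_nneseries => [n _ _|n _]; first exact: integral_ge0.
    rewrite !uI//.
    have -> : (del / (2 ^ n.+1)%:R)%:E = (del%:E * (1 / (2 ^ n.+1)%:R)%:E)%E.
      by rewrite -EFinM mul1r.
    rewrite -ge0_muleDr ?lee_fin ?divr_ge0//.
    rewrite lee_pmul2l//.
    have [_ AV /ltW VA] := Vprop n.
    have AD : A n `&` D = A n by apply/setIidPl; exact: subIsetl.
    rewrite AD; apply: (@le_trans _ _ (mu (V n))).
      apply: le_measure; rewrite ?inE; [|exact: mV|exact: subIsetl].
      exact: (measurableI _ _ (mV n) mD).
    have -> : (mu (V n) = mu (A n) + mu (V n `\` A n))%E.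
      rewrite -[in LHS](setDUK AV).
      apply: (measureU (@lebesgue_measure R) (mA n) (measurableD (mV n) (mA n))).
      by rewrite setIC setDKI.
    exact: leeD2l.
  apply: (le_trans le1).
  apply: (le_trans (epsilon_trick _ _ (ltW del0))).
    by move=> n; exact: integral_ge0.
  rewrite -integral_nneseries//; last by move=> n; exact: mu_.
  have uAle x : D x -> (\sum_(0 <= n <oo) u A n x <= (h x)%:E + del%:E)%E.
    move=> Dx; apply: lime_le; first exact: is_cvg_nneseries.
    apply: nearW => N /=; rewrite big_mkord sumEFin -EFinD lee_fin.
    (* Both bounds go through one induction: a new term is nonzero only when [N%:R * del < h x], and
       then the first bound keeps the previous partial sum below [h x]. *)
    suff [] : (\sum_(i < N) del * \1_(A i) x <= N%:R * del) /\
              (\sum_(i < N) del * \1_(A i) x <= h x + del) by [].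
    elim: N => [|N [IH1 IH2]].
      by rewrite big_ord0 mul0r lexx; split=> //; rewrite addr_ge0 ?h0// ltW.
    rewrite big_ord_recr/= indicE -natr1 mulrDl mul1r.
    have [NA|] := boolP (x \in A N); rewrite /= ?mulr1 ?mulr0 ?addr0.
      split; first by rewrite lerD2r.
      rewrite lerD2r (le_trans IH1)//; move: NA; rewrite inE => -[_ /=].
      exact: ltW.
    by move=> _; split=> //; rewrite (le_trans IH1)// lerDl ltW.
  have hI : (\int[mu]_(x in D) (\sum_(0 <= n <oo) u A n x) <=
     \int[mu]_(x in D) (h x)%:E + (del * fine (mu D))%:E)%E.
    apply: (@le_trans _ _ (\int[mu]_(x in D) ((h x)%:E + (cst del%:E) x))%E).
      apply: ge0_le_integral => //.
      - by move=> x _; exact: nneseries_ge0.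
      - by apply: ge0_emeasurable_sum => // n _; exact: mu_.
      - by apply/measurable_EFinP; apply: measurable_funD.
    rewrite (@ge0_integralD _ _ _ (@lebesgue_measure R) D mD (EFin \o h) (cst del%:E)).
    - by rewrite integral_cst// [X in (_ * X)%E]muD -EFinM.
    - by move=> x /h0; rewrite lee_fin.
    - exact/measurable_EFinP.
    - by move=> x _; rewrite lee_fin ltW.
    - exact: measurable_cst.
  apply: (le_trans (leeD2r _ hI)).
  rewrite -addeA -EFinD leeD2l// lee_fin -{2}[del]mulr1 -mulrDr /del divfK//.
  by rewrite gt_eqF// ltr_wpDl.
Qed.

(* The derivative is truncated from below at [- n], so that the shifted
   truncation [h] is nonnegative. The neighbourhood bound on [v >= h] makes
   [T = F + (n - eta) * id] grow to the right of every point no faster than the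
   indefinite integral [Psi] of [v]. *)
Lemma increment_le_Rintegral (R : realType) (a b : R) (F f : R -> R) :
  a < b -> {within `[a, b], continuous F} ->
  (forall x, a < x < b -> is_derive x 1 F (f x)) ->
  (@lebesgue_measure R).-integrable `[a, b] (EFin \o f) ->
  F b - F a <= \int[lebesgue_measure]_(x in `[a, b]) f x.
Proof.
move=> ab cF dF fint; apply/ler_addgt0Pr => e e0.
set mu := @lebesgue_measure R; pose D := `[a, b]%classic : set R.
have mD : measurable D by exact: measurable_itv.
have muD : mu D = (b - a)%:E by rewrite /mu /D lebesgue_measure_itv/= lte_fin ab.
have mf : measurable_fun D f by apply/measurable_EFinP; exact: measurable_int fint.
have e30 : 0 < e / 3 by rewrite divr_gt0.
pose fn (n : nat) x := Num.max (f x) (- n%:R).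
have fn_le n x : `|fn n x| <= `|f x|.
  rewrite /fn; case: (leP (- n%:R) (f x)) => // fx.
  have n0 : (0 : R) <= n%:R by [].
  by rewrite normrN ger0_norm// ler0_norm; lra.
have mfn n : measurable_fun D (fn n) by apply: measurable_maxr.
have fnint n : mu.-integrable D (EFin \o fn n).
  apply: (@le_integrable _ _ _ mu D mD _ (EFin \o f)).
  - by apply/measurable_EFinP; exact: mfn.
  - by move=> x _; rewrite /= lee_fin fn_le.
  - exact: fint.
(* Dominated convergence with the bound [|f|]: at each point the truncation stops acting once [n]
   exceeds [|f x|]. *)
have [n fn_f] : exists n, \int[mu]_(x in D) fn n x <= \int[mu]_(x in D) f x + e / 3.
  have [_ _] : [/\ mu.-integrable D (EFin \o f),
      [sequence (\int[mu]_(x in D) `|(fn n x)%:E - (f x)%:E|)%E]_n @ \oo --> 0%E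
      & [sequence (\int[mu]_(x in D) (fn n x)%:E)%E]_n @ \oo
          --> (\int[mu]_(x in D) (f x)%:E)%E].
    apply: (@dominated_convergence _ _ _ mu D mD (fun n => EFin \o fn n)
       (EFin \o f) (abse \o (EFin \o f))).
    - by move=> n; apply/measurable_EFinP; exact: mfn.
    - by apply/measurable_EFinP; exact: mf.
    - apply: aeW => x _; apply: cvg_near_cst.
      exists (Num.truncn `|f x|).+1 => // n /= ltn.
      congr EFin; rewrite /fn max_l// lerNl.
      have := truncnS_gt `|f x|; have : (Num.truncn `|f x|).+1%:R <= n%:R :> R.
        by rewrite ler_nat.
      by have := ler_norm (- f x); rewrite normrN; lra.
    - exact: integrable_abse.
    - by apply: aeW => x n _; rewrite /= lee_fin fn_le.
  have -> : (\int[mu]_(x in D) (f x)%:E)%E = (\int[mu]_(x in D) f x)%:E.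
    by rewrite fineK//; exact: integrable_fin_num.
  move=> /fine_cvgP[_ /cvgrPdist_le/(_ _ e30)[N _ /(_ N (leqnn N))]] /=.
  move=> fN; exists N; rewrite -lerBlDl; apply: le_trans fN.
  by rewrite distrC ler_norm.
pose h x := fn n x + n%:R.
have h0 x : 0 <= h x by rewrite /h -lerBlDr sub0r le_max lexx orbT.
have mh : measurable_fun D h by apply: measurable_funD.
have [|v [mv v0 v_ge v_int]] := vitali_caratheodory_ge0 mD _ mh (fun x _ => h0 x) e30.
  by rewrite [X in (X < _)%E]muD ltry.
have h_int : (\int[mu]_(x in D) (h x)%:E =
    (\int[mu]_(x in D) fn n x + n%:R * (b - a))%:E)%E.
  have cint : mu.-integrable D (EFin \o cst (n%:R : R)).
    apply/integrableP; split; first exact/measurable_EFinP.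
    rewrite /= integral_cst//= [X in (_ * X)%E]muD -EFinM; exact: ltry.
  have hint : mu.-integrable D (EFin \o h).
    have -> : EFin \o h = ((EFin \o fn n) \+ (EFin \o cst n%:R))%E by [].
    exact: integrableD.
  rewrite -[LHS]fineK; last exact: integrable_fin_num.
  congr EFin; rewrite -[LHS]/(\int[mu]_(x in D) (fn n x + cst n%:R x)).
  by rewrite RintegralD// Rintegral_cst// [X in fine X]muD.
have v_fin (E : set R) : measurable E -> E `<=` D ->
    (\int[mu]_(x in E) v x)%E \is a fin_num.
  move=> mE ED; rewrite ge0_fin_numE; last by apply: integral_ge0.
  apply: (@le_lt_trans _ _ (\int[mu]_(x in D) v x)%E).
    by apply: ge0_subset_integral => //; exact: measurable_funTS.
  by apply: (le_lt_trans v_int); rewrite [X in (X + _)%E]h_int -EFinD ltry.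
pose Psi x := fine (\int[mu]_(t in `[a, x]) v t).
have subD x : x <= b -> `[a, x] `<=` D.
  by move=> xb t /=; rewrite /D /= !in_itv/= => /andP[-> /le_trans]; exact.
have PsiD x y : a <= x -> x <= y -> y <= b ->
    Psi y - Psi x = fine (\int[mu]_(t in `]x, y]) v t)%E.
  move=> ax xy yb; have xb := le_trans xy yb.
  have sub_xy : `]x, y] `<=` D.
    move=> t /=; rewrite /D /= !in_itv/= => /andP[xt ty].
    by rewrite (le_trans ax (ltW xt)) (le_trans ty yb).
  have -> : Psi y = Psi x + fine (\int[mu]_(t in `]x, y]) v t)%E.
    rewrite /Psi -fineD; [|exact: v_fin (subD _ xb)|exact: v_fin].
    congr fine; rewrite -ge0_integral_setU//=.
    - by rewrite -itv_bndbnd_setU// bnd_simp.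
    - exact: measurable_funTS.
    - rewrite disj_set2E; apply/eqP/seteqP; split=> // t [] /=.
      by rewrite !in_itv/= => /andP[_ tx] /andP[/(le_lt_trans tx)]; rewrite ltxx.
  by rewrite addrAC subrr add0r.
(* The three errors [e / 3] come from the truncation, from the majorant [v], and from lowering the
   slope of [T] by [eta] over the length [b - a]. *)
pose eta := e / 3 / (b - a).
have ba0 : 0 < b - a by rewrite subr_gt0.
have eta0 : 0 < eta by rewrite divr_gt0.
have etaE : eta * (b - a) = e / 3 by rewrite divfK// gt_eqF.
pose T x := F x + (n%:R - eta) * x.
have : T b - T a <= Psi b - Psi a.
  apply: increment_le_of_right_growth => //.
  - apply: within_continuousD => //; apply: continuous_subspaceT => x.
    by apply: cvgM; [exact: cvg_cst | exact: cvg_id].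
  - move=> x y; rewrite !in_itv/= => /andP[ax _] /andP[_ yb] xy.
    by rewrite -subr_ge0 PsiD// fine_ge0// integral_ge0.
  - move=> x axb; have /andP[ax xb] := axb; have dFx := dF x axb.
    have Dx : D x by rewrite /D /= in_itv/= !ltW.
    have [r1 r10 Fr1] : exists2 r, 0 < r & forall t, 0 < t < r ->
        F (x + t) - F x <= (f x + eta) * t.
      have := @ex_derive _ _ _ _ _ _ _ dFx => /cvgrPdist_le.
      have := @derive_val _ _ _ _ _ _ _ dFx; rewrite /derive => ->.
      move=> /(_ _ eta0); rewrite near_withinE => /nbhs_ballP[r /= r0 rF].
      exists r => // t /andP[t0 tr].
      have : ball 0 r t by rewrite /ball/= sub0r normrN gtr0_norm.
      move=> /rF/(_ (lt0r_neq0 t0)); rewrite scaler1 distrC.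
      move=> /(le_trans (ler_norm _)); rewrite lerBlDr /GRing.scale/=.
      rewrite -(ler_pM2r t0) mulrAC mulVf ?gt_eqF// mul1r.
      by rewrite [t + x]addrC [eta + _]addrC.
    have [r2 r20 vr2] : exists2 r, 0 < r & forall y, `|x - y| < r -> ((h x)%:E <= v y)%E.
      by have /nbhs_ballP[r /= r0 rv] := v_ge x Dx; exists r.
    (* Half of the smallest of three bounds: the difference quotient of [F] is controlled, [v] stays
       above [h x], and [x + t] stays below [b]. *)
    pose t := Num.min (Num.min r1 r2) (b - x) / 2.
    have m0 : 0 < Num.min (Num.min r1 r2) (b - x).
      by rewrite !lt_min r10 r20 subr_gt0.
    have t0 : 0 < t by rewrite divr_gt0.
    have : t < Num.min (Num.min r1 r2) (b - x).
      by rewrite ltr_pdivrMr// ltr_pMr// ltr1n.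
    rewrite !lt_min => /andP[/andP[tr1 tr2] tb].
    have yb : x + t <= b by rewrite -lerBrDl ltW.
    exists (x + t); first by rewrite ltrDl t0.
    rewrite PsiD ?(ltW ax) ?lerDl ?(ltW t0)//.
    (* The [- eta] in the slope of [T] absorbs the error of the difference quotient and leaves
       [(f x + n%:R) * t]; the bound [h x <= v] is then integrated over []x, x + t]]. *)
    apply: (@le_trans _ _ (h x * t)).
      have := Fr1 t; rewrite t0 tr1 => /(_ isT).
      have : (f x + n%:R) * t <= h x * t.
        by rewrite ler_pM2r// lerD2r le_max lexx.
      rewrite /T; lra.
    have mxt : (h x * t)%:E = (\int[mu]_(y in `]x, (x + t)%R]) (h x)%:E)%E.
      rewrite integral_cst// [X in (_ * X)%E]lebesgue_measure_itv/= lte_fin ltrDl t0.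
      by rewrite -EFinB -EFinM addrAC subrr add0r.
    rewrite -[leLHS]/(fine (h x * t)%:E) mxt fine_le//.
    + by rewrite -mxt.
    + apply: v_fin => // y /=; rewrite /D /= !in_itv/= => /andP[xy yxt].
      by rewrite (le_trans (ltW ax) (ltW xy)) (le_trans yxt yb).
    + apply: ge0_le_integral => //.
      * by move=> y _; rewrite lee_fin.
      * exact: measurable_funTS.
      * move=> y /=; rewrite in_itv/= => /andP[xy yxt]; apply: vr2.
        by rewrite distrC gtr0_norm ?subr_gt0// ltrBlDl (le_lt_trans yxt)// ltrD2l.
have Psi_a : 0 <= Psi a by rewrite fine_ge0// integral_ge0.
have Psi_b : Psi b <= \int[mu]_(x in D) fn n x + n%:R * (b - a) + e / 3.
  rewrite -lee_fin fineK; last exact: v_fin.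
  by rewrite EFinD -h_int.
(* The terms [n%:R * (b - a)] in [T] and in the bound on [Psi b] cancel, and the three errors sum to
   [e]. *)
move: Psi_a Psi_b fn_f etaE; rewrite /T -/D; nra.
Qed.

(** The one-sided bound is applied to [F] and to [- F]. *)
Lemma Rintegral_is_derive (R : realType) (a b : R) (F f : R -> R) :
  a < b -> {within `[a, b], continuous F} ->
  (forall x, a < x < b -> is_derive x 1 F (f x)) ->
  (@lebesgue_measure R).-integrable `[a, b] (EFin \o f) ->
  \int[lebesgue_measure]_(x in `[a, b]) f x = F b - F a.
Proof.
move=> ab cF dF fint; apply/eqP; rewrite eq_le increment_le_Rintegral// andbT.
rewrite -[leRHS]opprK lerNr opprB.
have -> : F a - F b = - F b - - F a by rewrite opprK addrC.
have -> : - (\int[lebesgue_measure]_(x in `[a, b]) f x) =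
    \int[lebesgue_measure]_(x in `[a, b]) (- f x).
  rewrite -mulN1r -RintegralZl//.
  by apply: eq_Rintegral => x _; rewrite mulN1r.
apply: (increment_le_Rintegral (F := fun x => - F x) (f := fun x => - f x)) => //.
- by move=> x; apply: continuousN; exact: cF.
- by move=> x /dF dFx; exact: is_deriveN.
- exact: (integrableN fint).
Qed.

(** * Differential calculus of row-vector-valued maps *)

Lemma differentiable_mulmx_tr (R : realType) (V : normedModType R) (p : nat)
  (phi : V -> 'rV[R]_p) (c : 'rV[R]_p) (v : V) :
  differentiable phi v -> differentiable (fun w => (c *m (phi w)^T) 0 0) v.
Proof.
move=> dphi.
have -> : (fun w => (c *m (phi w)^T) 0 0) =
    \sum_(a < p) (fun w => c 0 a *: (phi w 0 a)).
  by apply/funext => w; rewrite mxE fct_sumE; apply: eq_bigr => a _; rewrite !mxE.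
apply: differentiable_sum => a; apply: differentiableZ.
apply: (@differentiable_comp _ _ _ _ phi (fun w : 'rV[R]_p => w 0 a)) => //.
exact: differentiable_coord.
Qed.

Lemma linear_rV_differentiable (R : realType) (m p : nat)
  (A : {linear 'rV[R]_m -> 'rV[R]_p}) (v : 'rV[R]_m) : differentiable A v.
Proof.
have -> : (A : _ -> _) = \sum_(j < m) (fun w : 'rV[R]_m => w 0 j *: A (delta_mx 0 j)).
  apply/funext => w; rewrite fct_sumE {1}[w]row_sum_delta linear_sum.
  by apply: eq_bigr => j _; rewrite linearZ.
apply: differentiable_sum => j; apply: differentiableZl.
exact: differentiable_coord.
Qed.

(** The Jacobian of an affine map is its linear part at every base point [u], so the first-order
    expansion has no remainder. *)
Lemma mixed_deriv_affine (R : realType) (d p q m : nat)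
  (f : 'rV[R]_d -> 'rV[R]_p -> 'rV[R]_q) (l : 'rV[R]_q -> 'rV[R]_m -> R)
  (x : 'rV[R]_d) (th : 'rV[R]_p) (u v w : 'rV[R]_m) :
  sample_grad_affine f l ->
  mixed_deriv f l x th u *m (v - w)^T =
  (sample_grad f l x v th - sample_grad f l x w th)^T.
Proof.
move=> /(_ x th)[A [b gE]]; rewrite /mixed_deriv -trmx_mul !gE opprD addrACA subrr addr0.
have -> : (fun w' => sample_grad f l x w' th) = (A : _ -> _) + cst b.
  by apply/funext => w'; rewrite gE.
have cA : continuous A.
  by move=> z; exact/differentiable_continuous/linear_rV_differentiable.
have dA := linear_rV_differentiable A u.
have dAb : differentiable ((A : _ -> _) + cst b) u by exact: differentiableD.
(* The product with the Jacobian is read as a directional derivative, to which the constant term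
   contributes zero. *)
rewrite -deriveEjacobian//.
have -> : 'D_(v - w) ((A : 'rV[R]_m -> 'rV[R]_p) + cst b) u = A (v - w).
  have := is_deriveD (derivableP (diff_derivable dA)) (is_derive_cst b u (v - w)).
  move=> /(@derive_val _ _ _ _ _ _ _) ->; rewrite addr0 deriveE//.
  by have /= -> := diff_lin u cA.
by rewrite linearB.
Qed.

(** Chain rule along a curve, asking for differentiability of [phi] only at the point [r t]; this is
    what lets the mixed derivative be discontinuous. *)
Lemma is_derive_mulmx_tr_path (R : realType) (p m : nat) (phi : 'rV[R]_m -> 'rV[R]_p)
  (c : 'rV[R]_p) (r : R -> 'rV[R]_m) (t : R) :
  derivable r t 1 -> differentiable phi (r t) ->
  is_derive t 1 (fun s => (c *m (phi (r s))^T) 0 0)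
    ((c *m ('J phi (r t))^T *m (derive1 r t)^T) 0 0).
Proof.
move=> dr dphi.
have dpr : is_derive t 1 (phi \o r) ('d phi (r t) (derive1 r t)).
  have drt : differentiable r t by apply/derivable1_diffP.
  have dc : differentiable (phi \o r) t by exact: differentiable_comp.
  apply: DeriveDef; first exact: diff_derivable.
  by rewrite deriveE// diff_comp//= derive1E deriveE.
have -> : (fun s => (c *m (phi (r s))^T) 0 0) =
    \sum_(a < p) (fun s => c 0 a *: (phi (r s) 0 a)).
  apply/funext => s; rewrite mxE fct_sumE; apply: eq_bigr => a _.
  by rewrite !mxE.
have -> : (c *m ('J phi (r t))^T *m (derive1 r t)^T) 0 0 =
    \sum_(a < p) (c 0 a *: ('d phi (r t) (derive1 r t)) 0 a).
  rewrite -mulmxA -trmx_mul -deriveEjacobian// deriveE// mxE.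
  by apply: eq_bigr => a _; rewrite !mxE.
apply: is_derive_sum => a.
apply: is_deriveZ; apply: DeriveDef.
  have /derivable_mxP := @ex_derive _ _ _ _ _ _ _ dpr; exact.
have := @derive_mx _ _ _ _ _ _ _ (@ex_derive _ _ _ _ _ _ _ dpr).
by rewrite derive_val => ->; rewrite mxE.
Qed.

(** * Losses whose parameter gradient is affine in the target *)

Lemma mse_sample_grad_affine (R : realType) (d p m : nat)
  (g : 'rV[R]_d -> 'rV[R]_p -> 'rV[R]_m) :
  (forall a th, differentiable (g a) th) -> sample_grad_affine g mse.
Proof.
move=> dg a th.
pose gk k u := g a u 0 k.
have dgk k e : derivable (gk k) th e.
  by have /derivable_mxP := diff_derivable (v := e) (dg a th); exact.
(* In the derivative of the squared errors, [2 * (gk k th - v 0 k)] times the partial derivative of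
   [gk k], [B] collects the coefficients of [v 0 k] and [b] the rest. *)
pose B : 'M[R]_(m, p) := \matrix_(k, j) (- 2 * m%:R^-1 * 'D_(delta_mx 0 j) (gk k) th).
pose b : 'rV[R]_p :=
  \row_j (m%:R^-1 * \sum_k 2 * gk k th * 'D_(delta_mx 0 j) (gk k) th).
exists (mulmxr B), b => v; apply/rowP => j; rewrite !mxE /=.
have -> : (fun u => mse (g a u) v) =
    m%:R^-1 *: \sum_(k < m) (gk k - cst (v 0 k)) ^+ 2.
  by apply/funext => u; rewrite /mse /= fctE fct_sumE.
have dd k : is_derive th (delta_mx 0 j) ((gk k - cst (v 0 k)) ^+ 2)
   (2 * (gk k th - v 0 k) * 'D_(delta_mx 0 j) (gk k) th).
  have d1 := derivableP (dgk k (delta_mx 0 j)).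
  by apply: is_derive_eq; rewrite subr0 expr1.
have ds := is_derive_sum dd.
rewrite (@derive_val _ _ _ _ _ _ _ (is_deriveZ _ ds)).
rewrite /GRing.scale /= mulr_sumr mulr_sumr -big_split /=; apply: eq_bigr => k _.
by rewrite !mxE; ring.
Qed.

(** The loss is already linear in the target, so its gradient has no constant term; positive
    probabilities make the logarithms differentiable. *)
Lemma cross_entropy_sample_grad_affine (R : realType) (d p m : nat)
  (g : 'rV[R]_d -> 'rV[R]_p -> 'rV[R]_m) :
  (forall a th, differentiable (g a) th) ->
  (forall a th k, 0 < g a th 0 k) -> sample_grad_affine g cross_entropy.
Proof.
move=> dg g0 a th.
pose gk k u := g a u 0 k.
have dgk k e : derivable (fun u => ln (gk k u)) th e.
  apply: diff_derivable; apply: differentiable_comp.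
    apply: (@differentiable_comp _ _ _ _ (g a) (fun w : 'rV[R]_m => w 0 k)) => //.
    exact: differentiable_coord.
  by apply/derivable1_diffP; apply: ex_derive; apply: is_derive1_ln; exact: g0.
pose B : 'M[R]_(m, p) := \matrix_(k, j) (- 'D_(delta_mx 0 j) (fun u => ln (gk k u)) th).
exists (mulmxr B), 0 => v; apply/rowP => j; rewrite !mxE /= addr0.
have -> : (fun u => cross_entropy (g a u) v) =
    - \sum_(k < m) v 0 k *: (fun u => ln (gk k u)).
  by apply/funext => u; rewrite /cross_entropy /= fctE fct_sumE.
have dd k := is_deriveZ (v 0 k) (derivableP (dgk k (delta_mx 0 j))).
rewrite (@derive_val _ _ _ _ _ _ _ (is_deriveN (is_derive_sum dd))).
by rewrite -sumrN; apply: eq_bigr => k _; rewrite !mxE mulrN.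
Qed.

(** * The influence function as an integrated influence *)

Theorem lemma2p5 (R : realType) (d p q m N : nat) (Z : Type)
  (f : 'rV[R]_d -> 'rV[R]_p -> 'rV[R]_q) (l : 'rV[R]_q -> 'rV[R]_m -> R)
  (Ltest : Z -> 'rV[R]_p -> R) (z : Z)
  (x : 'I_N -> 'rV[R]_d) (y y' : 'I_N -> 'rV[R]_m)
  (M : set 'rV[R]_m) (rho : 'I_N -> R -> 'rV[R]_m)
  (theta : @dataset R d m N -> 'rV[R]_p)
  (hrho : forall i, target_path M (y' i) (y i) (rho i))
  (htheta : forall t, t \in `[0, 1] ->
     is_minimizer (train_loss f l (path_dataset x rho t)) (theta (path_dataset x rho t)))
  (hderiv : path_derivs_exist f l Ltest z theta x rho)
  (hy' : forall i,
     differentiable (fun u => l (f (x i) u) (y' i)) (theta (mk_dataset x y)) /\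
     sample_grad f l (x i) (y' i) (theta (mk_dataset x y)) = 0) :
  [/\
      (forall s t, s \in `[0, 1] -> t \in `[0, 1] ->
         path_grad Ltest z theta x rho s = path_grad Ltest z theta x rho t /\
         path_hessian f l theta x rho s = path_hessian f l theta x rho t) ->
      forall i,
        (forall t, t \in `[0, 1] ->
           mixed_deriv_exists f l (x i) (theta (mk_dataset x y)) (rho i t) /\
           path_mixed f l theta x rho i t
             = mixed_deriv f l (x i) (theta (mk_dataset x y)) (rho i t)) ->
        (@lebesgue_measure R).-integrable `[0, 1]
          (EFin \o path_integrand f l Ltest z theta x rho i) ->
        integrated_influence f l Ltest z theta x rho i
          = influence f l Ltest z theta x y i,
      sample_grad_affine f l ->
      forall i (s : nat -> R), s 0%N = 0 -> s 1%N = 1 ->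
        discrete_integrated_influence f l Ltest z theta x rho 1 s i
          = influence f l Ltest z theta x y i /\
        - (path_grad Ltest z theta x rho (s 1%N)
             *m invmx (path_hessian f l theta x rho (s 1%N))
             *m path_mixed f l theta x rho i (s 1%N) *m (y i - y' i)^T) 0 0
          = influence f l Ltest z theta x y i,
      forall g : 'rV[R]_d -> 'rV[R]_p -> 'rV[R]_m,
        (forall a th, differentiable (g a) th) -> sample_grad_affine g mse &
      forall g : 'rV[R]_d -> 'rV[R]_p -> 'rV[R]_m,
        (forall a th, differentiable (g a) th) ->
        (forall a th k, 0 < g a th 0 k) -> sample_grad_affine g cross_entropy].
Proof.
have rho0 i : rho i 0 = y' i by have [] := hrho i.
have rho1 i : rho i 1 = y i by have [] := hrho i.
have D1 : path_dataset x rho 1 = mk_dataset x y.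
  by congr mk_dataset; apply/funext => i; exact: rho1.
have in1 : (1 : R) \in `[0, 1] by rewrite in_itv/= ler01 lexx.
(* At [t = 1] the parameter is the minimizer for the true targets, where the gradient at [y' i]
   vanishes; only the gradient at [y i] survives in the increment. *)
have discr : sample_grad_affine f l -> forall i,
    - (path_grad Ltest z theta x rho 1 *m invmx (path_hessian f l theta x rho 1)
         *m path_mixed f l theta x rho i 1 *m (y i - y' i)^T) 0 0
      = influence f l Ltest z theta x y i.
  move=> aff i; rewrite /path_mixed -mulmxA mixed_deriv_affine//.
  by rewrite /path_grad /path_hessian D1 (hy' i).2 subr0.
split.
- move=> GH i J fint.
  pose th := theta (mk_dataset x y).
  pose phi v := sample_grad f l (x i) v th.
  pose c := path_grad Ltest z theta x rho 1 *m invmx (path_hessian f l theta x rho 1).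
  have [[crho drho _] _ _ _] := hrho i.
  have FTC : \int[lebesgue_measure]_(t in `[0, 1]) path_integrand f l Ltest z theta x rho i t
      = (c *m (phi (rho i 1))^T) 0 0 - (c *m (phi (rho i 0))^T) 0 0.
    apply: (Rintegral_is_derive (F := fun t => (c *m (phi (rho i t))^T) 0 0)) => //.
    (* Continuity is needed up to the end points, where the path has no two-sided derivative; it
       follows from differentiability of [phi] at every [rho i t] with [t] in [[0, 1]]. *)
    + apply: (@within_continuous_comp _ _ _ _ (rho i) (fun v => (c *m (phi v)^T) 0 0)) => //.
      move=> v; rewrite inE => -[t t01 <-]; have [[_ dphi] _] := J t t01.
      exact/differentiable_continuous/differentiable_mulmx_tr.
    + move=> t t01; have t01' : t \in `[0, 1].
        by case/andP: t01 => t0 t1; rewrite in_itv/= !ltW.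
      (* [GH] freezes the gradient and the Hessian at [t = 1], and [Jt] moves the mixed derivative
         to the parameter [th], turning the integrand into an exact derivative. *)
      have [[_ dphi] Jt] := J t t01'; have [Gt Ht] := GH t 1 t01' in1.
      rewrite /path_integrand Gt Ht Jt.
      have drt : derivable (rho i) t 1 by apply: drho; rewrite in_itv.
      exact: (is_derive_mulmx_tr_path c drt dphi).
  rewrite /integrated_influence FTC rho1 rho0 /phi (hy' i).2 trmx0 mulmx0.
  by rewrite [X in _ - X]mxE subr0 /c /path_grad /path_hessian D1.
- move=> aff i s s0 s1; rewrite /discrete_integrated_influence big_nat1 /= s0 s1.
  by rewrite rho0 rho1; split; exact: discr.
- exact: mse_sample_grad_affine.
- exact: cross_entropy_sample_grad_affine.
Qed.
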